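(* Let $M$ be a real square matrix of size $2(n+1)$ having real Jordan form, and with no other eigenvalues than $\pm\mathrm i$. Then the equation $\nabla f=M\nabla g$ can be extended to the system $$A_\mu\nabla V_\mu\equiv0\pmod{(\mu^2+1)^{n+1}},$$ where $$A_\mu=M^{-1}+\mu I,\qquad V_\mu=V_0+V_1\mu+\cdots+V_{2n+1}\mu^{2n+1},$$ and $V_0=f$, $V_{2n+1}=g$. That is: if $V_\mu$ is a solution of this system, then $(f,g)=(V_0,V_{2n+1})$ satisfies $\nabla f=M\nabla g$; and for every solution $(f,g)$ of $\nabla f=M\nabla g$ there exist functions $V_1,\dots,V_{2n}$, uniquely determined up to additive constants by $(f,g)$, such that $V_\mu$ with $V_0=f$, $V_{2n+1}=g$ is a solution of the system.
   Context: Functions are real-valued and smooth on an open convex domain of a real vector space of dimension $2(n+1)$; $\nabla$ is the column vector of partial derivatives with respect to linear coordinates. ''$M$ has real Jordan form with no other eigenvalues than $\pm\mathrm i$'' means $M=\mathrm{diag}(M_1,\dots,M_m)$ where each $M_i$ is a block matrix built of $2\times2$ blocks, with $\Lambda=\begin{bmatrix}0&1\\-1&0\end{bmatrix}$ in every diagonal block position, the $2\times2$ identity matrix in every position on the first block superdiagonal, and zeros elsewhere. $\mu$ is a formal parameter, and $\equiv0\pmod{(\mu^2+1)^{n+1}}$ means that each component, as a polynomial in $\mu$, is divisible by $(\mu^2+1)^{n+1}$. *)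

(* Defs.v *)
From mathcomp Require Import all_boot all_order all_algebra.
From mathcomp Require Import boolp classical_sets reals topology normedtype.
From mathcomp Require Import derive convex.

Set Implicit Arguments.
Unset Strict Implicit.
Unset Printing Implicit Defensive.

Import Order.TTheory GRing.Theory Num.Theory.
Import numFieldNormedType.Exports.

Local Open Scope classical_set_scope.
Local Open Scope ring_scope.

(* Points of the domain are coordinate row vectors in
   'rV[R]_N; gradients are column vectors. A function on a domain U is
   represented by a total function of which only the values on U matter. *)

Section Smooth.
Variables (R : realType) (N : nat).
Implicit Types (U : set 'rV[R]_N) (f : 'rV[R]_N -> R).

Definition partial (i : 'I_N) f : 'rV[R]_N -> R :=
  fun x => 'D_(delta_mx 0 i) f x.

Definition grad f (x : 'rV[R]_N) : 'cV[R]_N := \col_i partial i f x.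

(* Meant for open U only: then continuity and partial derivatives at a point
   of U depend on the restriction of f to U alone. *)
Fixpoint Ck_on U (k : nat) f : Prop :=
  (forall x, U x -> {for x, continuous f}) /\
  if k is k'.+1 then
    forall i, (forall x, U x -> derivable f x (delta_mx 0 i)) /\
              Ck_on U k' (partial i f)
  else True.

Definition smooth_on U f : Prop := forall k, Ck_on U k f.

End Smooth.

Section RealJordan.
Variable R : realType.

(* [0 1; -1 0] *)
Definition Lambda : 'M[R]_2 :=
  \matrix_(i, j) (if (i < j)%N then 1 else if (j < i)%N then -1 else 0).

Definition real_jordan_block (k : nat) : 'M[R]_(\sum_(i < k) 2) :=
  \mxblock_(i < k, j < k)
    (if i == j then Lambda else if j == i.+1 :> nat then 1%:M else 0).

(* Real Jordan form with no other eigenvalues than +i and -i. The cast only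
   identifies the sum of the sizes of the blocks with N. *)
Definition real_jordan_form_pm_i (N : nat) (M : 'M[R]_N) : Prop :=
  exists (m : nat) (k : 'I_m -> nat)
         (eN : (\sum_(i < m) \sum_(j < k i) 2)%N = N),
    (forall i, (0 < k i)%N) /\
    M = castmx (eN, eN) (\mxdiag_(i < m) real_jordan_block (k i)).

End RealJordan.

Section System.
Variables (R : realType) (n : nat).

(* (2 * n).+2 = 2 (n + 1) is both the dimension and the number of coefficients
   of V_mu; this form makes ord0 and ord_max (= 2 n + 1) available. *)
Local Notation N := (2 * n).+2.
Implicit Types (M : 'M[R]_N) (U : set 'rV[R]_N) (f g : 'rV[R]_N -> R)
  (V : 'I_N -> 'rV[R]_N -> R).

Definition gradient_equation M U f g : Prop :=
  forall x, U x -> grad f x = M *m grad g x.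

(* The formal parameter mu is 'X. *)
Definition A_mu M : 'M[{poly R}]_N := map_mx polyC (invmx M) + 'X%:M.

Definition grad_V_mu V (x : 'rV[R]_N) : 'cV[{poly R}]_N :=
  \sum_(k < N) 'X^k *: map_mx polyC (grad (V k) x).

(* A polynomial in mu with function coefficients is divisible by the monic
   constant-coefficient polynomial (mu^2 + 1)^(n+1) iff it is so pointwise. *)
Definition mu_system_solution M U V : Prop :=
  (forall k, smooth_on U (V k)) /\
  forall x, U x -> forall i,
    ('X^2 + 1) ^+ n.+1 %| (A_mu M *m grad_V_mu V x) i 0.

Definition has_ends U f g V : Prop :=
  forall x, U x -> V ord0 x = f x /\ V ord_max x = g x.

End System.

(* Main.v *)
Require Import Defs.
From HB Require Import structures.
From mathcomp Require Import all_boot all_order all_algebra.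
From mathcomp Require Import boolp classical_sets reals topology normedtype.
From mathcomp Require Import derive convex.
From mathcomp Require Import functions landau realfun.
From mathcomp Require Import ereal measure lebesgue_measure.
From mathcomp Require Import lebesgue_integral ftc lra.

Set Implicit Arguments.
Unset Strict Implicit.
Unset Printing Implicit Defensive.

Import Order.TTheory GRing.Theory Num.Theory.
Import numFieldNormedType.Exports.

Local Open Scope classical_set_scope.
Local Open Scope ring_scope.

(** Write N = 2(n+1), P = (mu^2 + 1)^(n+1) with coefficients c_k, and
d_k for the gradient of V_k. Each component of A_mu grad V_mu has degree at
most N in mu, and P is monic of degree N, so divisibility by P leaves only one
possible quotient, the coefficient of mu^N, which is d_(N-1) = grad g.
Comparing the other coefficients, the system is equivalent to the recurrence
  M^-1 d_k + d_(k-1) = c_k grad g   for 0 <= k < N, with d_(-1) = 0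
([mu_system_recurrence]). Since c_0 = 1, its instance k = 0 reads
grad f = M grad g, which is the first claim. Read downwards from
d_(N-1) = grad g, the recurrence determines every d_k, hence every V_k up to a
constant on the convex domain ([mu_system_grad_unique], [same_grad_const]).

For existence, put Y = - M^-1. The downward recurrence is Horner's scheme, with
solution d_k = B_k grad g, where B_k is P stripped of its monomials of degree
at most k, divided by mu^(k+1), and evaluated at Y. It closes up at k = 0
because P(Y) = 0: on each Jordan block M^2 + 1 is strictly upper block
triangular, so that (M^2 + 1)^(n+1) = 0, and P(Y) = M^(-2(n+1)) (M^2 + 1)^(n+1)
([jordan_nilpotent], [horner_modulus_opp_inv]). What remains is
that B_k grad g is a gradient. Let H be the Hessian of g. The equation
grad f = M grad g says that M H is the Hessian of f, hence symmetric, that is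
M H = H M^T. This relation passes from M to Y and to every polynomial in Y
([selfadjoint_opp_inv], [selfadjoint_horner]), so B_k H, the Jacobian matrix of
B_k grad g, is symmetric, and the Poincare lemma on the convex domain provides
V_k ([exists_potential]).

The analysis is built from partial derivatives: continuous partial derivatives
imply differentiability ([differentiable_of_partials]), mixed second
derivatives commute ([partial_comm]), and a smooth closed field on a convex
open set has the potential obtained by integrating along the rays from a base
point, by differentiation under the integral sign ([is_derive_potential]). *)

(** * Nilpotency of M^2 + 1 for a real Jordan form *)

Section BlockUpper.
Variables (R : pzRingType) (k : nat) (p_ : 'I_k -> nat).
Local Notation sp := (\sum_(i < k) p_ i)%N.

Definition block_upper (d : nat) (A : 'M[R]_sp) : Prop :=
  forall i j : 'I_k, (j < i + d)%N -> submxblock A i j = 0.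

(** A product of blocks A i l * B l j survives only if i + d <= l and l + e <= j:
the offsets from the diagonal add up. *)
Lemma block_upper_mul d e (A B : 'M[R]_sp) :
  block_upper d A -> block_upper e B -> block_upper (d + e) (A *m B).
Proof.
move=> hA hB i j hij.
rewrite -[A]submxblockK -[B]submxblockK mul_mxblock mxblockK.
apply: big1 => l _; have [li|li] := ltnP l (i + d); first by rewrite hA ?mul0mx.
by rewrite hB ?mulmx0 // (leq_trans hij)// addnA leq_add2r.
Qed.

Lemma block_upper1 : block_upper 0 (1%:M : 'M[R]_sp).
Proof.
move=> i j; rewrite addn0 => ji.
rewrite -mxdiagZ /mxdiag mxblockK ifF//.
by apply/negP => /eqP eij; rewrite eij ltnn in ji.
Qed.

Lemma block_upper_exp (A : 'M[R]_sp) e :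
  block_upper 1 A -> block_upper e (A ^+ e).
Proof.
move=> hA; elim: e => [|e IH]; first exact: block_upper1.
by rewrite exprS -add1n; exact: block_upper_mul.
Qed.

Lemma block_upper_eq0 d (A : 'M[R]_sp) :
  (k <= d)%N -> block_upper d A -> A = 0.
Proof.
move=> kd hA; apply/mxblockP => i j; rewrite submxblock0 hA//.
by rewrite (leq_trans (ltn_ord j))// (leq_trans kd)// leq_addl.
Qed.

Lemma expr_mxdiag (B_ : forall i : 'I_k, 'M[R]_(p_ i)) e :
  (\mxdiag_i B_ i) ^+ e = \mxdiag_i (B_ i ^+ e).
Proof.
elim: e => [|e IH]; first by rewrite -[LHS]mxdiagZ.
rewrite exprS IH -[LHS]/(_ *m _) {2}/mxdiag mul_mxdiag_mxblock /mxdiag.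
apply: eq_mxblock => i j; case: eqP => [eij|]; last by rewrite mulmx0.
by case: _ / eij; rewrite !conform_mx_id exprS.
Qed.

End BlockUpper.

Section Jordan.
Variable R : realType.

Lemma sqr_Lambda : Lambda R *m Lambda R = - 1%:M.
Proof.
apply/matrixP => i j; rewrite !mxE big_ord_recl big_ord1 !mxE.
by case: i => [[|[|]] //= ?]; case: j => [[|[|]] //= ?];
  rewrite ?(mul0r, mulr0, mul1r, mulr1, addr0, add0r, oppr0).
Qed.

(** The diagonal blocks of the square are Lambda^2 = - 1, cancelled by the
identity; squaring keeps the lower blocks zero. *)
Lemma block_upper_jordan_sqr k :
  block_upper 1 (real_jordan_block R k *m real_jordan_block R k + 1%:M).
Proof.
move=> i j; rewrite addn1 ltnS => ji.
rewrite submxblockD -mxdiagZ /mxdiag mxblockK mul_mxblock mxblockK.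
have blk0 (a b : 'I_k) : (b < a)%N ->
    (if a == b then Lambda R else if b == a.+1 :> nat then 1%:M else 0) = 0.
  move=> ba; rewrite !ifF//; first by apply/eqP => e;
    rewrite e ltnNge leqnSn in ba.
  by apply/eqP => e; rewrite e ltnn in ba.
move: ji; rewrite leq_eqVlt => /predU1P[/val_inj ->|ji].
  rewrite (bigD1 i)//= !eqxx conform_mx_id sqr_Lambda big1 ?addr0 ?addNr//.
  move=> l li; have [lti|] := ltnP l i; first by rewrite (blk0 _ _ lti) mul0mx.
  rewrite leq_eqVlt => /predU1P[/val_inj e|il]; first by rewrite e eqxx in li.
  by rewrite (blk0 _ _ il) mulmx0.
rewrite ifF ?addr0; last by apply/eqP => e; rewrite e ltnn in ji.
apply: big1 => l _; have [lti|il] := ltnP l i.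
  by rewrite (blk0 _ _ lti) mul0mx.
by rewrite [X in _ *m X]blk0 ?mulmx0// (leq_trans ji).
Qed.

(** A Jordan block has at most p rows of 2 x 2 blocks, so the p-th power of a
strictly upper block triangular matrix of its shape is 0. *)
Lemma jordan_nilpotent N p (M : 'M[R]_N) :
  real_jordan_form_pm_i M -> N = p.*2 -> (M *m M + 1%:M) ^+ p = 0.
Proof.
case=> m [k [eN [_ ->]]] eNp; move: eNp; case: _ / eN => hp.
rewrite castmx_id.
have -> : (\mxdiag_i real_jordan_block R (k i)) *m
    (\mxdiag_i real_jordan_block R (k i)) + 1%:M =
    \mxdiag_i (real_jordan_block R (k i) *m real_jordan_block R (k i) + 1%:M).
  by rewrite mxdiagD mxdiagZ -[X in X + _]expr2 expr_mxdiag.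
rewrite expr_mxdiag -[RHS]mxdiag0.
apply: eq_mxdiag => i; apply: block_upper_eq0; last first.
  by apply: block_upper_exp; exact: block_upper_jordan_sqr.
rewrite -leq_double -hp (bigD1 i)//= sum_nat_const card_ord -muln2.
exact: leq_addr.
Qed.

End Jordan.

(** * The modulus and polynomials in a matrix *)

Section MatrixPoly.
Variables (R : realType) (n : nat).
Local Notation N := (2 * n).+2.
Implicit Types (M A H : 'M[R]_N) (p : {poly R}).

Definition modulus : {poly R} := ('X^2 + 1) ^+ n.+1.

Lemma size_sqrX1 : size ('X^2 + 1 : {poly R}) = 3.
Proof. by rewrite size_polyDl size_polyXn ?size_poly1. Qed.

Lemma monic_sqrX1 : ('X^2 + 1 : {poly R}) \is monic.
Proof.
by apply/monicP; rewrite lead_coefDl ?size_polyXn ?size_poly1// lead_coefXn.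
Qed.

Lemma monic_modulus : modulus \is monic.
Proof. exact/monic_exp/monic_sqrX1. Qed.

Lemma size_modulus : size modulus = N.+1.
Proof.
have := size_exp ('X^2 + 1 : {poly R}) n.+1; rewrite size_sqrX1 -/modulus => e.
rewrite -(prednK (n := size modulus)).
  by rewrite e mulnS.
by rewrite size_poly_gt0 monic_neq0 ?monic_modulus.
Qed.

Lemma modulus0 : modulus`_0 = 1.
Proof. by rewrite -horner_coef0 !hornerE expr0n/= add0r expr1n. Qed.

(** One step of Horner's scheme for the evaluation of p at A. *)
Lemma horner_mx_drop (A : 'M[R]_N) p k :
  horner_mx A (drop_poly k p) =
    A * horner_mx A (drop_poly k.+1 p) + (p`_k)%:M.
Proof.
have -> : drop_poly k p = 'X * drop_poly k.+1 p + (p`_k)%:P.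
  apply/polyP => i; rewrite coefD coefXM coefC !coef_drop_poly.
  by case: i => [|i]; rewrite ?add0r//= addr0 addSnnS.
by rewrite rmorphD rmorphM/= horner_mx_X horner_mx_C.
Qed.

(** The modulus has constant term 1, so it writes 1 as a multiple of M once it
vanishes at M. *)
Lemma unitmx_of_nilpotent M : (M *m M + 1%:M) ^+ n.+1 = 0 -> M \in unitmx.
Proof.
move=> M0.
have : horner_mx M modulus = 0.
  by rewrite rmorphXn rmorphD rmorphXn /= horner_mx_X rmorph1.
rewrite -[modulus]drop_poly0l horner_mx_drop modulus0 => /eqP.
rewrite addr_eq0 -eqr_oppLR -mulrN => /eqP/mulmx1_unit[].
by [].
Qed.

(** M^-2 + 1 = M^-2 (M^2 + 1), and the two factors commute. *)
Lemma horner_modulus_opp_inv M : (M *m M + 1%:M) ^+ n.+1 = 0 ->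
  horner_mx (- invmx M) modulus = 0.
Proof.
move=> M0; have uM := unitmx_of_nilpotent M0.
rewrite rmorphXn rmorphD rmorphXn /= horner_mx_X rmorph1 sqrrN.
have -> : invmx M ^+ 2 + 1 = (invmx M ^+ 2) * (M *m M + 1%:M).
  rewrite mulrDr mulr1 addrC expr2; congr (_ + _).
  rewrite -[RHS]/((invmx M *m invmx M) *m (M *m M)).
  by rewrite mulmxA mulmxKV// mulVmx.
rewrite exprMn_comm ?M0 ?mulr0//.
rewrite /GRing.comm mulrDr mulrDl; congr (_ + _); last by rewrite mulr1 mul1r.
rewrite expr2.
rewrite -[LHS]/((invmx M *m invmx M) *m (M *m M)).
rewrite -[RHS]/((M *m M) *m (invmx M *m invmx M)).
by rewrite !mulmxA mulmxKV// mulmxK// mulVmx// mulmxV.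
Qed.

(** When H is symmetric, A H = H A^T says that A is self-adjoint for the bilinear
form H; such matrices are closed under polynomials and inverses, which is how
the symmetry of M H propagates to all the B_k H. *)
Lemma selfadjoint_horner A H p : A *m H = H *m A^T ->
  horner_mx A p *m H = H *m (horner_mx A p)^T.
Proof.
move=> AH; elim/poly_ind: p => [|p c IH].
  by rewrite rmorph0 trmx0 mul0mx mulmx0.
rewrite rmorphD rmorphM/= horner_mx_X horner_mx_C.
rewrite linearD/= tr_scalar_mx mulmxDl mulmxDr; congr (_ + _).
  rewrite -[_ * A]/(_ *m _) trmx_mul -mulmxA AH mulmxA IH -mulmxA.
  congr (_ *m _); rewrite -!trmx_mul; congr (_^T).
  exact: comm_mx_horner.
by rewrite scalar_mxC.
Qed.

Lemma selfadjoint_opp_inv M H : M \in unitmx -> M *m H = H *m M^T ->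
  - invmx M *m H = H *m (- invmx M)^T.
Proof.
move=> uM MH; rewrite linearN/= mulNmx mulmxN; congr (- _).
have uMT : M^T \in unitmx by rewrite unitmx_tr.
by rewrite trmx_inv -[X in _ *m X](mulmxK uMT) -MH !mulmxA mulVmx// mul1mx.
Qed.

(** The family is indexed by nat and vanishes from N on, so that the coefficient
formula needs no upper boundary case. *)
Lemma coef_A_mu M (D : nat -> 'cV[R]_N) i k :
  (forall j, (N <= j)%N -> D j = 0) ->
  ((A_mu M *m (\sum_(j < N) 'X^j *: map_mx polyC (D j))) i 0)`_k =
  (invmx M *m D k + (if k is k'.+1 then D k' else 0)) i 0.
Proof.
move=> D0; set w := \sum_(j < N) _.
have cw a l : (w a 0)`_l = D l a 0.
  rewrite summxE coef_sum.
  under eq_bigr do rewrite !mxE coefXnM coefC.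
  have [lN|Nl] := ltnP l N.
    rewrite (bigD1 (Ordinal lN))//= ltnn subnn eqxx big1 ?addr0//.
    move=> j jl; case: ltnP => // lj; rewrite subn_eq0 ifF//.
    apply/negP => jl'; move/eqP: jl; apply; apply/val_inj/eqP => /=.
    by rewrite eqn_leq lj jl'.
  rewrite D0// mxE big1// => j _.
  rewrite ltnNge (leq_trans (ltnW (ltn_ord j)) Nl)/= subn_eq0 ifF//.
  by rewrite leqNgt (leq_trans (ltn_ord j) Nl).
rewrite mulmxDl mxE coefD [RHS]mxE; congr (_ + _).
  rewrite !mxE coef_sum; apply: eq_bigr => j _.
  by rewrite mxE coefCM cw.
rewrite mul_scalar_mx mxE coefXM; case: k => [|k]/=; first by rewrite mxE.
by rewrite cw.
Qed.

(** The degree of the dividend is at most the degree N of the monic modulus: the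
quotient is a constant, read off as the coefficient of degree N. *)
Lemma dvd_A_mu_iff M (D : nat -> 'cV[R]_N) :
  (forall j, (N <= j)%N -> D j = 0) ->
  (forall i, modulus %|
     (A_mu M *m (\sum_(j < N) 'X^j *: map_mx polyC (D j))) i 0) <->
  (forall k, (k < N)%N -> invmx M *m D k + (if k is k'.+1 then D k' else 0) =
     modulus`_k *: D N.-1).
Proof.
move=> D0; set w := A_mu M *m _.
have cw i k := coef_A_mu M i k D0.
have mN : modulus`_N = 1.
  by have := monicP monic_modulus; rewrite lead_coefE size_modulus.
split=> [dvd k kN|rec i].
  apply/matrixP => i j; rewrite [j]ord1 -cw -/w.
  have /dvdpP[q wq] := dvd i.
  have q0 : q = (D N.-1 i 0)%:P.
    have sq : (size q <= 1)%N.
      have [->|q0] := eqVneq q 0; first by rewrite size_poly0.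
      have sw : (size (w i 0%R) <= N.+1)%N.
        apply/leq_sizeP => l Nl; rewrite cw.
        case: l Nl => // l Nl; rewrite !D0 ?(ltnW Nl)//.
        by rewrite mulmx0 addr0 mxE.
      move: sw; rewrite wq size_Mmonic ?monic_modulus// size_modulus.
      by rewrite addnS /= -[X in (_ <= X)%N -> _]add1n leq_add2r.
    rewrite (size1_polyC sq); congr (_%:P).
    have : (w i 0)`_N = D N.-1 i 0 by rewrite cw D0// mulmx0 add0r.
    by rewrite wq [in X in X -> _](size1_polyC sq) coefCM mN mulr1.
  by rewrite wq q0 coefCM mxE mulrC.
apply/dvdpP; exists (D N.-1 i 0)%:P; apply/polyP => k; rewrite coefCM cw.
have [kN|] := ltnP k N; first by rewrite rec// mxE mulrC.
rewrite leq_eqVlt => /predU1P[<-|Nk].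
  by rewrite mN mulr1 D0// mulmx0 add0r.
rewrite (nth_default _ (s := modulus)) ?size_modulus// mulr0.
by case: k Nk => // k Nk; rewrite !D0 ?(ltnW Nk)// mulmx0 addr0 mxE.
Qed.

End MatrixPoly.

(** * From partial derivatives to differentiability *)

Lemma continuous_at_sum (R : realType) (T : topologicalType) (I : Type)
    (r : seq I) (F : I -> T -> R) (x : T) :
  (forall i, {for x, continuous (F i)}) ->
  {for x, continuous (fun y => \sum_(i <- r) F i y)}.
Proof.
move=> cF; elim: r => [|i r IH].
  have -> : (fun y => \sum_(i <- [::]) F i y) = (fun=> 0).
    by apply/funext => y; rewrite big_nil.
  exact: cvg_cst.
have -> : (fun y => \sum_(j <- i :: r) F j y) =
    (fun y => F i y + \sum_(j <- r) F j y).
  by apply/funext => y; rewrite big_cons.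
exact: cvgD (cF i) IH.
Qed.

Section Lines.
Variables (R : realType) (V : normedModType R).
Implicit Types (f : V -> R) (x v : V).

Lemma is_derive_along f x v (t : R) : derivable f (x + t *: v) v ->
  is_derive t 1 (fun s : R => f (x + s *: v)) ('D_v f (x + t *: v)).
Proof.
move=> df.
have E : (fun h : R => h^-1 *:
      (((fun s : R => f (x + s *: v)) \o shift t) (h *: 1) - f (x + t *: v))) =
    (fun h : R => h^-1 *:
      ((f \o shift (x + t *: v)) (h *: v) - f (x + t *: v))).
  apply/funext => h /=; congr (_ *: (f _ - _)).
  by rewrite /= [h *: 1]mulr1 scalerDl addrCA.
by apply: DeriveDef; rewrite /derivable /derive E.
Qed.

Lemma is_derive_scale f x v (a : R) : derivable f x v ->
  is_derive x (a *: v) f (a * 'D_v f x).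
Proof.
move=> df.
have d0 : is_derive (0 * a : R) 1 (fun s : R => f (x + s *: v)) ('D_v f x).
  have := @is_derive_along f x v (0 * a).
  by rewrite mul0r scale0r addr0; apply.
have da : is_derive (0 : R) 1 (fun s : R => s * a) a.
  have := @is_deriveM R R (fun s => s) (fun=> a) 0 1 _ _
    (is_derive_id _ _) (is_derive_cst _ _ _).
  by rewrite /= scaler0 add0r [_ *: _]mulr1; apply.
have [dc vc] := @is_derive1_comp R (fun s => f (x + s *: v))
  (fun s => s * a) 0 _ _ d0 da.
have E : (fun h : R => h^-1 *: ((f \o shift x) (h *: (a *: v)) - f x)) =
    (fun h : R => h^-1 *:
      ((((fun s : R => f (x + s *: v)) \o (fun s : R => s * a)) \o shift 0)
         (h *: 1) - ((fun s : R => f (x + s *: v)) \o (fun s : R => s * a)) 0)).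
  apply/funext => h /=; rewrite !mul0r scale0r addr0 [h *: 1]mulr1 addr0.
  by rewrite scalerA [x + _]addrC.
by apply: DeriveDef; rewrite /derivable /derive E // mulrC.
Qed.

Lemma MVT_along f x v :
  (forall t : R, 0 <= t <= 1 -> derivable f (x + t *: v) v) ->
  exists2 t : R, 0 <= t <= 1 & f (x + v) - f x = 'D_v f (x + t *: v).
Proof.
move=> df; have d (t : R) : t \in `[0, 1] ->
    is_derive t 1 (fun s : R => f (x + s *: v)) ('D_v f (x + t *: v)).
  by rewrite in_itv /= => t01; apply: is_derive_along; exact: df.
pose g (s : R) := f (x + s *: v); pose dg (s : R) := 'D_v f (x + s *: v).
have dg1 (t : R) : t \in `]0, 1[%R -> is_derive t 1 g (dg t).
  by move=> t01; apply: d; exact: subset_itv_oo_cc.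
have cg : {within `[0, 1], continuous g}.
  by apply: derivable_within_continuous => t /d [].
have [c] := MVT_segment ler01 dg1 cg; rewrite /g /dg.
by rewrite in_itv /= subr0 mulr1 scale1r scale0r addr0 => c01; exists c.
Qed.

End Lines.

Section Gradient.
Variables (R : realType) (N : nat).
Implicit Types (U : set 'rV[R]_N) (f : 'rV[R]_N -> R) (x v h : 'rV[R]_N).

Lemma MVT_partial f i x (a : R) :
  (forall t : R, 0 <= t <= 1 ->
     derivable f (x + (t * a) *: delta_mx 0 i) (delta_mx 0 i)) ->
  exists2 t : R, 0 <= t <= 1 & f (x + a *: delta_mx 0 i) - f x =
    a * partial i f (x + (t * a) *: delta_mx 0 i).
Proof.
move=> df.
have d (t : R) : 0 <= t <= 1 -> is_derive (x + t *: (a *: delta_mx 0 i))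
    (a *: delta_mx 0 i) f (a * partial i f (x + (t * a) *: delta_mx 0 i)).
  by move=> t01; rewrite scalerA; apply: is_derive_scale; exact: df.
have [t /d[]//|t t01 ->] := @MVT_along R _ f x (a *: delta_mx 0 i).
by exists t => //; case: (d t t01).
Qed.

(** The only candidate for the differential of f at x. *)
Definition grad_form f x v : R := \sum_(i < N) v 0 i * partial i f x.

Fact grad_form_is_linear f x : linear (grad_form f x).
Proof.
move=> a u v; rewrite scaler_sumr -big_split; apply: eq_bigr => i _ /=.
by rewrite !mxE mulrDl -mulrA.
Qed.
HB.instance Definition _ f x := GRing.isLinear.Build R 'rV[R]_N R _
  (grad_form f x) (grad_form_is_linear f x).

Lemma continuous_grad_form f x : continuous (grad_form f x).
Proof.
move=> v; apply: (@continuous_at_sum R) => i.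
by apply: (@cvgMr_tmp R _ (nbhs v)); exact: (@coord_continuous R 1 N 0 i v).
Qed.

(** The points x + trunc_row k h, for k from 0 to N, lead from x to x + h by
changing one coordinate at a time. *)
Definition trunc_row (k : nat) h : 'rV[R]_N :=
  \row_j (if (j < k)%N then h 0 j else 0).

Lemma trunc_rowS (k : 'I_N) h :
  trunc_row k.+1 h = trunc_row k h + h 0 k *: delta_mx 0 k.
Proof.
apply/rowP => j; rewrite !mxE eqxx /= ltnS leq_eqVlt.
have [->|jk] := eqVneq j k; first by rewrite eqxx ltnn mulr1 add0r.
by rewrite [_ == _ :> nat](negbTE jk) mulr0 addr0.
Qed.

Lemma norm_row_le v (b : R) : 0 <= b ->
  (forall j, `|v 0 j| <= b) -> `|v| <= b.
Proof.
move=> b0 vb; rewrite /Num.Def.normr/= mx_normrE (bigmax_le _ b0)//= => -[i j] _.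
by rewrite [i]ord1.
Qed.

Lemma mx_entry_le v j : `|v 0 j| <= `|v|.
Proof.
rewrite [leRHS]/Num.Def.normr/= mx_normrE.
exact: (le_bigmax _ (fun i : 'I_1 * 'I_N => `|v i.1 i.2|) (0, j)).
Qed.

(** All points of the staircase from x to x + h are within `|h| of x, the norm
being the maximum norm. *)
Lemma norm_trunc_row (k : 'I_N) h (t : R) : 0 <= t <= 1 ->
  `|trunc_row k h + (t * h 0 k) *: delta_mx 0 k| <= `|h|.
Proof.
move=> /andP[t0 t1]; apply: norm_row_le => // j.
apply: le_trans (mx_entry_le h j); rewrite !mxE eqxx /=.
have [->|jk] := eqVneq j k.
  by rewrite ltnn add0r mulr1 normrM ger0_norm ?ler_piMl.
by rewrite mulr0 addr0; case: ifP; rewrite ?normr0.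
Qed.

(** The increment f (x + h) - f x is the sum of the increments along the edges of
the staircase; by the mean value theorem each is h_k times a value of the k-th
partial derivative near x, which differs little from its value at x. *)
Lemma differentiable_of_partials U f x : open U -> U x ->
  (forall i y, U y -> derivable f y (delta_mx 0 i)) ->
  (forall i, {for x, continuous (partial i f)}) ->
  differentiable f x.
Proof.
move=> oU Ux df cf.
suff dfE : (f \o shift x : 'rV[R]_N -> R) =
    cst (f x) + grad_form f x +o_ (0 : 'rV[R]_N) id.
  have e := diff_unique (df := grad_form f x) (@continuous_grad_form f x) dfE.
  by apply/diff_locallyP; rewrite e; split => //; exact: continuous_grad_form.
apply/eqaddoP => _/posnumP[e].
(* N.+1 rather than N: the dimension may be 0. *)
have e' : 0 < e%:num / N.+1%:R by rewrite divr_gt0.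
have : \forall y \near x, U y /\
    forall i, `|partial i f x - partial i f y| <= e%:num / N.+1%:R.
  near=> y; split; first by near: y; exact: open_nbhs_nbhs.
  near: y; apply: filter_forall => i.
  by have /cvgrPdist_le := cf i; apply.
move=> /nbhs_ballP[d /= d0 hd].
near=> h; have hd' : `|h| < d.
  by near: h; have := @pseudometric_normed_Zmodule.nbhs0_lt R 'rV[R]_N d d0;
    rewrite near_simpl.
have pt (k : 'I_N) (t : R) : 0 <= t <= 1 ->
    U (x + trunc_row k h + (t * h 0 k) *: delta_mx 0 k) /\
    `|partial k f x -
       partial k f (x + trunc_row k h + (t * h 0 k) *: delta_mx 0 k)|
      <= e%:num / N.+1%:R.
  move=> t01; rewrite -addrA.
  have [|? ?] := hd (x + (trunc_row k h + (t * h 0 k) *: delta_mx 0 k));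
    last by split.
  rewrite -ball_normE /ball_ /= opprD addNKr normrN.
  exact: le_lt_trans (norm_trunc_row _ _ t01) hd'.
suff : `|f (h + x) - (f x + grad_form f x h)| <= e%:num * `|h| by [].
have -> : f (h + x) - (f x + grad_form f x h) =
    \sum_(k < N) (f (x + trunc_row k.+1 h) - f (x + trunc_row k h)
                  - h 0 k * partial k f x).
  rewrite sumrB opprD addrA; congr (_ - _).
  rewrite -(big_mkord xpredT
    (fun k => f (x + trunc_row k.+1 h) - f (x + trunc_row k h))).
  rewrite telescope_sumr//; congr (f _ - f _).
    by rewrite addrC; congr (_ + _); apply/rowP => j; rewrite mxE ltn_ord.
  by rewrite -[LHS]addr0; congr (_ + _); apply/rowP => j; rewrite !mxE.
apply: (@le_trans _ _ (\sum_(k < N) `|h| * (e%:num / N.+1%:R))).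
  apply: le_trans (ler_norm_sum _ _ _) _; apply: ler_sum => k _.
  rewrite trunc_rowS addrA.
  have [t t01|t t01 ->] := @MVT_partial f k (x + trunc_row k h) (h 0 k).
    by apply: df; case: (pt k t t01).
  rewrite -mulrBr normrM; apply: ler_pM => //; first exact: mx_entry_le.
  by rewrite distrC; case: (pt k t t01).
rewrite sumr_const card_ord -[leLHS]mulr_natr -mulrA mulrC ler_wpM2r//.
by rewrite -mulrA ler_piMr// ler_pdivrMl// mulr1 ler_nat.
Unshelve. all: by end_near. Qed.

Lemma derive_grad_form f x v : differentiable f x -> 'D_v f x = grad_form f x v.
Proof.
move=> df; rewrite deriveE// {1}(row_sum_delta v) linear_sum.
apply: eq_bigr => i _; rewrite linearZ /=; congr (_ * _).
by rewrite /partial deriveE.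
Qed.

End Gradient.

(** * Smooth functions and symmetry of second derivatives *)

Section Smooth.
Variables (R : realType) (N : nat).
Implicit Types (U : set 'rV[R]_N) (f g : 'rV[R]_N -> R) (x v h : 'rV[R]_N).

Lemma near_eq_on U f g x : open U -> U x -> (forall y, U y -> f y = g y) ->
  \near x, f x = g x.
Proof.
move=> oU Ux fg; near=> y; apply: fg.
near: y; exact: open_nbhs_nbhs.
Unshelve. all: by end_near. Qed.

Lemma partial_eq_on U f g i x : open U -> U x -> (forall y, U y -> f y = g y) ->
  partial i f x = partial i g x.
Proof. by move=> oU Ux fg; apply: near_eq_derive; exact: near_eq_on fg. Qed.

Lemma continuous_at_eq_on U f g x : open U -> U x ->
  (forall y, U y -> f y = g y) ->
  {for x, continuous f} -> {for x, continuous g}.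
Proof.
move=> oU Ux fg; rewrite /prop_for /continuous_at -(fg x Ux) => cf.
apply: cvg_trans cf; apply: (@near_eq_cvg _ _ (nbhs x)).
exact: near_eq_on fg.
Qed.

(** Partial derivatives are total functions with arbitrary values off U; this
lemma replaces them by formulas that hold on U alone. *)
Lemma Ck_on_eq U k f g : open U -> (forall x, U x -> f x = g x) ->
  Ck_on U k f -> Ck_on U k g.
Proof.
move=> oU; elim: k f g => [|k IH] f g fg /=.
  move=> [cf _]; split => // x Ux.
  exact: continuous_at_eq_on fg (cf x Ux).
move=> [cf df]; split => [x Ux|i].
  exact: continuous_at_eq_on fg (cf x Ux).
have [dfi cfi] := df i; split => [x Ux|].
  by apply: near_eq_derivable (dfi x Ux); exact: (near_eq_on oU Ux).
by apply: IH cfi => x Ux; exact: partial_eq_on fg.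
Qed.

Lemma Ck_on_lincomb U k f g (a : R) : open U ->
  Ck_on U k f -> Ck_on U k g -> Ck_on U k (fun x => a * f x + g x).
Proof.
move=> oU; elim: k f g => [|k IH] f g /=.
  move=> [cf _] [cg _]; split => // x Ux.
  by apply: cvgD (cg x Ux); apply: (@cvgMl_tmp R _ (nbhs x)); exact: cf.
move=> [cf df] [cg dg]; split => [x Ux|i].
  by apply: cvgD (cg x Ux); apply: (@cvgMl_tmp R _ (nbhs x)); exact: cf.
have [dfi cfi] := df i; have [dgi cgi] := dg i.
have d x : U x -> is_derive x (delta_mx 0 i) (fun x => a * f x + g x)
    (a * partial i f x + partial i g x).
  move=> Ux; have /derivableP df' := dfi x Ux; have /derivableP dg' := dgi x Ux.
  exact: (is_deriveD (is_deriveZ a df') dg').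
split => [x /d[]//|].
apply: Ck_on_eq (IH _ _ cfi cgi) => // x Ux.
by case: (d x Ux).
Qed.

Lemma smooth_on_cst U (c : R) : smooth_on U (fun=> c).
Proof.
move=> k; elim: k c => [|k IH] c /=.
  by split=> // x _; exact: cst_continuous.
split=> [x _|i]; first exact: cst_continuous.
split=> [x _|]; first exact: derivable_cst.
have -> : partial i (fun=> c) = fun=> 0 :> R.
  by apply/funext => x; exact: derive_cst.
exact: IH.
Qed.

Lemma smooth_on_sum U (I : Type) (r : seq I) (a : I -> R)
    (F : I -> 'rV[R]_N -> R) : open U ->
  (forall j, smooth_on U (F j)) ->
  smooth_on U (fun x => \sum_(j <- r) a j * F j x).
Proof.
move=> oU sF; elim: r => [|j r IH] k.
  apply: Ck_on_eq (smooth_on_cst _ 0 k) => // x _.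
  by rewrite big_nil.
apply: Ck_on_eq (Ck_on_lincomb (a j) oU (sF j k) (IH k)) => // x _.
by rewrite big_cons.
Qed.

Lemma smooth_on_spec U f : smooth_on U f ->
  [/\ forall x, U x -> {for x, continuous f},
      forall i x, U x -> derivable f x (delta_mx 0 i) &
      forall i, smooth_on U (partial i f)].
Proof.
move=> sf; have [cf df] := sf 1; split=> // [i x Ux|i k].
  by case: (df i) => + _; apply.
by have [_ /(_ i)[]] := sf k.+1.
Qed.

Lemma smooth_on_differentiable U f x : open U -> U x -> smooth_on U f ->
  differentiable f x.
Proof.
move=> oU Ux /smooth_on_spec[_ df sdf].
apply: (differentiable_of_partials oU Ux df) => i.
by have [cf _ _] := smooth_on_spec (sdf i); exact: cf.
Qed.

Lemma partial_sum m (a : 'I_m -> R) (F : 'I_m -> 'rV[R]_N -> R) i x :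
  (forall j, derivable (F j) x (delta_mx 0 i)) ->
  partial i (fun x => \sum_j a j * F j x) x = \sum_j a j * partial i (F j) x.
Proof.
move=> dF.
have dF' j : is_derive x (delta_mx 0 i) (a j \*: F j : 'rV[R]_N -> R)
    (a j *: partial i (F j) x).
  by apply: is_deriveZ; exact/derivableP.
have [_ <-] := is_derive_sum dF'; congr ('D_ _ _ x).
by apply/funext => y; rewrite fct_sumE.
Qed.

(** Two applications of the mean value theorem, first in direction i to
y |-> f (y + a e_j) - f y, then in direction j to partial i f. *)
Lemma second_difference f i j x (a : R) :
  (forall s t : R, 0 <= s <= 1 -> 0 <= t <= 1 ->
    let y := x + (s * a) *: delta_mx 0 i + (t * a) *: delta_mx 0 j in
    derivable f y (delta_mx 0 i) /\ derivable (partial i f) y (delta_mx 0 j)) ->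
  exists s t : R, [/\ 0 <= s <= 1, 0 <= t <= 1 &
    f (x + a *: delta_mx 0 i + a *: delta_mx 0 j) -
      f (x + a *: delta_mx 0 i) - (f (x + a *: delta_mx 0 j) - f x) =
    a * (a * partial j (partial i f)
      (x + (s * a) *: delta_mx 0 i + (t * a) *: delta_mx 0 j))].
Proof.
move=> df; set ei := delta_mx 0 i; set ej := delta_mx 0 j.
pose g y := f (y + a *: ej) - f y.
have dg (s : R) : 0 <= s <= 1 -> is_derive (x + (s * a) *: ei) ei g
    (partial i f (x + (s * a) *: ei + a *: ej) -
       partial i f (x + (s * a) *: ei)).
  move=> s01.
  have h01 (t : R) : t = 0 \/ t = 1 -> 0 <= t <= 1.
    by case=> ->; rewrite ?lexx ?ler01.
  have [+ _] := df s 1 s01 (h01 _ (or_intror erefl)).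
  have [+ _] := df s 0 s01 (h01 _ (or_introl erefl)).
  rewrite /= mul0r mul1r scale0r addr0 => /derivableP d0 /derivableP d1.
  apply: is_deriveB d0.
  have [d1' v1] := d1.
  have E : (fun h : R => h^-1 *: (((fun y => f (y + a *: ej)) \o
       shift (x + (s * a) *: ei)) (h *: ei) -
          f (x + (s * a) *: ei + a *: ej))) =
     (fun h : R => h^-1 *:
       ((f \o shift (x + (s * a) *: ei + a *: ej)) (h *: ei) -
          f (x + (s * a) *: ei + a *: ej))).
    by apply/funext => h /=; rewrite !addrA.
  by apply: DeriveDef; rewrite /derivable /derive /partial E.
have [s /dg[]//|s s01 gE] := @MVT_partial R N g i x a.
have [t t01|t t01 fE] := @MVT_partial R N (partial i f) j (x + (s * a) *: ei) a.
  by have [] := df s t s01 t01.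
exists s, t; split => //.
have [_ vg] := dg s s01.
by rewrite -fE -[X in a * X]vg -gE.
Qed.

Lemma ball_of_continuous2 U f g x (e : R) : open U -> U x ->
  {for x, continuous f} -> {for x, continuous g} -> 0 < e ->
  exists2 d : R, 0 < d & forall y, ball x d y ->
    [/\ U y, `|f x - f y| <= e & `|g x - g y| <= e].
Proof.
move=> oU Ux /cvgrPdist_le cf /cvgrPdist_le cg e0.
have : \forall y \near x, [/\ U y, `|f x - f y| <= e & `|g x - g y| <= e].
  near=> y; split; near: y; [exact: open_nbhs_nbhs|exact: cf|exact: cg].
by move=> /nbhs_ballP[d /= d0 hd]; exists d.
Unshelve. all: by end_near. Qed.

(** The second difference is symmetric in i and j, so on every small square
around x a value of one mixed derivative equals a value of the other; both are
continuous at x. *)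
Lemma partial_comm U f i j x : open U -> U x -> smooth_on U f ->
  partial i (partial j f) x = partial j (partial i f) x.
Proof.
move=> oU Ux sf.
have [_ df sdf] := smooth_on_spec sf.
apply/eqP; rewrite -subr_eq0 -normr_le0; apply/ler_addgt0Pl => e e0.
rewrite addr0.
have cij a b : {for x, continuous (partial a (partial b f))}.
  have [_ _ sd] := smooth_on_spec (sdf b).
  by have [cf _ _] := smooth_on_spec (sd a); exact: cf.
have e2 : 0 < e / 2 by rewrite divr_gt0.
have [d d0 hd] := ball_of_continuous2 oU Ux (cij i j) (cij j i) e2.
have box a b (s t : R) : 0 <= s <= 1 -> 0 <= t <= 1 ->
    ball x d (x + (s * (d / 3)) *: delta_mx 0 a + (t * (d / 3)) *: delta_mx 0 b).
  move=> /andP[s0 s1] /andP[t0 t1].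
  rewrite -ball_normE /ball_ /= -addrA opprD addNKr normrN.
  have nd (c : 'I_N) (r : R) : 0 <= r -> r <= 1 ->
      `|(r * (d / 3)) *: (delta_mx 0 c : 'rV[R]_N)| <= d / 3.
    move=> r0 r1; apply: norm_row_le => [|k]; first by rewrite divr_ge0 ?ltW.
    rewrite !mxE eqxx /= normrM ger0_norm ?mulr_ge0 ?divr_ge0 ?(ltW d0)//.
    case: (k == c); rewrite ?normr0 ?normr1 ?mulr1 ?mulr0 ?divr_ge0 ?(ltW d0)//.
    by rewrite ler_piMl// divr_ge0 ?(ltW d0).
  apply: le_lt_trans (ler_normD _ _) _.
  apply: (@le_lt_trans _ _ (d / 3 + d / 3)).
    by apply: lerD; exact: nd.
  lra.
have dif a b (s t : R) : 0 <= s <= 1 -> 0 <= t <= 1 ->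
    let y := x + (s * (d / 3)) *: delta_mx 0 a + (t * (d / 3)) *: delta_mx 0 b in
    derivable f y (delta_mx 0 a) /\ derivable (partial a f) y (delta_mx 0 b).
  move=> s01 t01 /=; have [Uy _ _] := hd _ (box a b s t s01 t01).
  split; first exact: df.
  by have [_ dfa _] := smooth_on_spec (sdf a); exact: dfa.
have [s [t [s01 t01 E1]]] := second_difference (dif i j).
have [s' [t' [s01' t01' E2]]] := second_difference (dif j i).
have [_ _ b1] := hd _ (box i j s t s01 t01).
have [_ b2 _] := hd _ (box j i s' t' s01' t01').
have d3 : d / 3 != 0 by rewrite gt_eqF// divr_gt0.
have inj (u v A B : R) :
    u = d / 3 * (d / 3 * A) -> v = d / 3 * (d / 3 * B) -> u = v -> A = B.
  by move=> -> -> AB; apply: (mulfI d3); apply: (mulfI d3).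
have close (p q A B : R) :
    `|p - A| <= e / 2 -> `|q - B| <= e / 2 -> A = B -> `|p - q| <= e.
  move=> pA qB AB; rewrite (splitr e); apply: le_trans (lerD pA qB).
  by rewrite AB -[X in _ <= _ + X]normrN; apply: le_trans (ler_normD _ _);
    rewrite opprB addrA subrK.
apply: (close _ _ _ _ b2 b1); apply: (inj _ _ _ _ E2 E1).
rewrite !opprD !opprK !addrA; congr (_ + _); rewrite -!addrA.
by congr (f (_ + _) + _); rewrite addrC.
Qed.

End Smooth.

(** * Functions on a convex open set *)

Section Convex.
Variables (R : realType) (N : nat).
Implicit Types (U : set 'rV[R]_N) (f g : 'rV[R]_N -> R) (x v h : 'rV[R]_N).

Lemma convex_set_along U x v (t : R) : convex_set U -> U x -> U (x + v) ->
  0 <= t <= 1 -> U (x + t *: v).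
Proof.
move=> cU Ux Uv t01.
have l01 : Itv.spec (@Itv.num_sem R) (Itv.Real `[0%Z, 1%Z]) t.
  by rewrite /= /Itv.num_sem /= in_itv /= num_real.
have /set_mem := cU (x + v) x (Itv.mk l01) (mem_set Uv) (mem_set Ux).
rewrite [X in U X](_ : _ = t *: (x + v) + (1 - t) *: x)//.
suff -> : t *: (x + v) + (1 - t) *: x = x + t *: v by [].
by rewrite scalerDr scalerBl scale1r addrAC addrCA subrr addr0 addrC.
Qed.

Lemma is_derive_smooth_along U f x v (t : R) : open U -> smooth_on U f ->
  U (x + t *: v) ->
  is_derive t 1 (fun s : R => f (x + s *: v)) (grad_form f (x + t *: v) v).
Proof.
move=> oU sf Ut; have df := smooth_on_differentiable oU Ut sf.
rewrite -(derive_grad_form _ df); apply: is_derive_along.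
exact: diff_derivable.
Qed.

Lemma constant_on_convex U f x y : open U -> convex_set U -> smooth_on U f ->
  (forall i z, U z -> partial i f z = 0) -> U x -> U y -> f y = f x.
Proof.
move=> oU cU sf f0 Ux Uy.
have Ut (t : R) : 0 <= t <= 1 -> U (x + t *: (y - x)).
  by move=> t01; apply: convex_set_along; rewrite // addrC subrK.
have df (t : R) : 0 <= t <= 1 -> differentiable f (x + t *: (y - x)).
  by move=> /Ut ?; exact: smooth_on_differentiable sf.
have [t t01|t t01] := @MVT_along R _ f x (y - x).
  exact/diff_derivable/df.
rewrite derive_grad_form; last exact: df.
rewrite [x + (y - x)]addrC subrK /grad_form big1 => [/subr0_eq//|i _].
by rewrite f0 ?mulr0//; exact: Ut.
Qed.

End Convex.

(** * Integrals over the unit interval *)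

Section Leibniz.
Variable R : realType.
Local Notation mu := (@lebesgue_measure R).

Lemma continuous_integrable01 (f : R -> R) : {within `[0, 1], continuous f} ->
  mu.-integrable `[0, 1] (EFin \o f).
Proof.
move=> cf; apply: continuous_compact_integrable => //.
exact: segment_compact.
Qed.

Lemma is_derive_under_integral01 (f df : R -> R -> R) (a d C : R) : 0 < d ->
  (forall s t, s \in `]a - d, a + d[ -> 0 <= t <= 1 ->
     is_derive s (1 : R) (f ^~ t) (df s t)) ->
  (forall s, s \in `]a - d, a + d[ -> {within `[0, 1], continuous (f s)}) ->
  (forall s t, s \in `]a - d, a + d[ -> 0 <= t <= 1 -> `|df s t| <= C) ->
  is_derive a (1 : R) (fun s => \int[mu]_(t in `[0, 1]) f s t)
    (\int[mu]_(t in `[0, 1]) df a t).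
Proof.
move=> d0 hf cf hC.
have aI : a \in `]a - d, a + d[ by rewrite in_itv /= ltrBlDr !ltrDl d0.
have d1E s t : s \in `]a - d, a + d[ -> 0 <= t <= 1 ->
    partial1of2 f s t = df s t.
  by move=> sI tI; rewrite partial1of2E; case: (hf s t sI tI).
have mI : measurable (`[0, 1]%classic : set R) by [].
have intf s : `]a - d, a + d[%classic s -> mu.-integrable `[0, 1] (EFin \o f s).
  by move=> sI; apply: continuous_integrable01; exact: cf.
have der s t : `]a - d, a + d[%classic s -> `[0, 1]%classic t ->
    derivable (f ^~ t) s 1.
  by move=> sI tI; case: (hf s t sI tI).
have C0 (t : R) : 0 <= `|C| by [].
have intC : mu.-integrable `[0, 1] (EFin \o (fun=> `|C|)).
  by apply: continuous_integrable01; apply: continuous_subspaceT;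
    exact: cst_continuous.
have ub s t : `]a - d, a + d[%classic s -> `[0, 1]%classic t ->
    `|partial1of2 f s t| <= `|C|.
  by move=> sI tI; rewrite d1E// (le_trans (hC _ _ sI tI))// ler_norm.
have dI := @derivable_under_integral R _ _ mu f _ mI _ _ _ aI intf der
  (fun=> `|C|) C0 intC ub.
apply: DeriveDef; first exact: dI.
rewrite -derive1E (@differentiation_under_integral R _ _ mu f _ mI _ _ _ aI
  intf der (fun=> `|C|) C0 intC ub).
by apply: eq_Rintegral => t /set_mem tI; rewrite d1E.
Qed.

Lemma FTC01 (f F : R -> R) :
  (forall t : R, 0 <= t <= 1 -> is_derive t 1 F (f t)) ->
  {within `[0, 1], continuous f} ->
  \int[mu]_(t in `[0, 1]) f t = F 1 - F 0.
Proof.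
move=> dF cf; rewrite /Rintegral (@continuous_FTC2 R f F)//.
  have cF (t : R) : 0 <= t <= 1 -> {for t, continuous F}.
    move=> /dF[d _]; apply: differentiable_continuous.
    exact/derivable1_diffP.
  split.
  - move=> t /subset_itv_oo_cc; rewrite in_itv /= => /dF[]//.
  - by apply: cvg_at_right_filter; apply: cF; rewrite lexx ler01.
  - by apply: cvg_at_left_filter; apply: cF; rewrite lexx ler01.
move=> t /subset_itv_oo_cc; rewrite in_itv /= => /dF[_ <-].
by rewrite derive1E.
Qed.

End Leibniz.

(** * The Poincare lemma on a convex open set *)

Section Poincare.
Variables (R : realType) (N : nat).
Variables (U : set 'rV[R]_N) (F : 'I_N -> 'rV[R]_N -> R) (x0 : 'rV[R]_N).
Local Notation mu := (@lebesgue_measure R).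
Hypotheses (oU : open U) (cU : convex_set U) (Ux0 : U x0).
Hypothesis sF : forall i, smooth_on U (F i).
Hypothesis closedF :
  forall i j x, U x -> partial i (F j) x = partial j (F i) x.

Definition radial (x : 'rV[R]_N) (t : R) : R :=
  \sum_j F j (x0 + t *: (x - x0)) * (x - x0) 0 j.

Definition potential (x : 'rV[R]_N) : R :=
  \int[mu]_(t in `[0, 1]) radial x t.

Let U_radial x (t : R) : U x -> 0 <= t <= 1 -> U (x0 + t *: (x - x0)).
Proof. by move=> Ux t01; apply: convex_set_along; rewrite // addrC subrK. Qed.

Let cont_along f x (t : R) : smooth_on U f -> U x -> 0 <= t <= 1 ->
  {for t, continuous (fun t : R => f (x0 + t *: (x - x0)))}.
Proof.
move=> sf Ux t01; apply: differentiable_continuous; apply/derivable1_diffP.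
by have [] := is_derive_smooth_along oU sf (U_radial Ux t01).
Qed.

Let within01 (f : R -> R) :
  (forall t : R, 0 <= t <= 1 -> {for t, continuous f}) ->
  {within `[0, 1], continuous f}.
Proof.
move=> cf; apply: continuous_in_subspaceT => t /set_mem.
by rewrite /= in_itv; exact: cf.
Qed.

Let radial_continuous x : U x -> {within `[0, 1], continuous (radial x)}.
Proof.
move=> Ux; apply: within01 => t t01; apply: (@continuous_at_sum R) => j.
by apply: (@cvgMr_tmp R _ (nbhs t)); exact: (cont_along (sF j) Ux t01).
Qed.

(** The derivative of radial x t as x moves in direction i, after exchanging the
indices of the derivatives of F. In this form it is also the derivative in t of
t * F i (x0 + t *: (x - x0)), and so its integral over t is F i x. *)
Definition dradial i (x : 'rV[R]_N) (t : R) : R :=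
  F i (x0 + t *: (x - x0)) + t * grad_form (F i) (x0 + t *: (x - x0)) (x - x0).

(** The product rule gives F i plus t times the sum over j of (x - x0)_j times
the i-th partial derivative of F j; closedness makes that sum the derivative
of F i along the ray. *)
Let is_derive_radial i x (s t : R) : U (x + s *: delta_mx 0 i) -> 0 <= t <= 1 ->
  is_derive s 1 (fun s : R => radial (x + s *: delta_mx 0 i) t)
    (dradial i (x + s *: delta_mx 0 i) t).
Proof.
move=> Us t01; set e := delta_mx 0 i; set y := x + s *: e.
have Up : U (x0 + t *: (y - x0)) := U_radial Us t01.
have pE r : x0 + t *: (x + r *: e - x0) = (x0 + t *: (x - x0)) + r *: (t *: e).
  rewrite -[RHS]addrA; congr (_ + _).
  rewrite [r *: (_ *: _)]scalerA [r * _]mulrC -scalerA -scalerDr.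
  by congr (_ *: _); rewrite addrAC.
have d j : is_derive s 1
    ((fun s : R => F j (x0 + t *: (x + s *: e - x0))) *
       (fun s : R => (x + s *: e - x0) 0 j))
    (F j (x0 + t *: (y - x0)) *: ((i == j)%:R : R) +
       (y - x0) 0 j *: (t * partial i (F j) (x0 + t *: (y - x0)))).
  apply: is_deriveM.
    have -> : (fun s : R => F j (x0 + t *: (x + s *: e - x0))) =
        (fun s : R => F j ((x0 + t *: (x - x0)) + s *: (t *: e))).
      by apply/funext => r; rewrite pE.
    have [_ df _] := smooth_on_spec (sF j).
    have [dt <-] := is_derive_scale t (df i _ Up).
    by rewrite /y pE in dt *; exact: is_derive_along.
  have -> : (fun s : R => (x + s *: e - x0) 0 j) =
      (fun s : R => ((x - x0) 0 j) + s * (i == j)%:R).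
    by apply/funext => r; rewrite !mxE eqxx /= addrAC eq_sym.
  have := @is_deriveD R R R (fun=> (x - x0) 0 j) (fun s => s * (i == j)%:R) s 1 _ _
    (is_derive_cst _ _ _) (@is_deriveM R R (fun s => s) (fun=> (i == j)%:R) s 1 _ _
       (is_derive_id _ _) (is_derive_cst _ _ _)).
  by rewrite /= scaler0 !add0r [_ *: _]mulr1; apply.
have [dd vd] := is_derive_sum d.
have E : (fun s : R => radial (x + s *: e) t) =
   (\sum_(j < N) ((fun s : R => F j (x0 + t *: (x + s *: e - x0))) *
       (fun s : R => (x + s *: e - x0) 0 j))).
  by apply/funext => r; rewrite fct_sumE.
rewrite E; apply: DeriveDef dd _; rewrite vd big_split /=; congr (_ + _).
  rewrite (bigD1 i)//= eqxx [_ *: _]mulr1 big1 ?addr0// => j ji.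
  by rewrite eq_sym (negbTE ji) scaler0.
rewrite mulr_sumr; apply: eq_bigr => j _.
by rewrite (closedF i j Up) [LHS]mulrCA.
Qed.

(** A constant dominating function for differentiation under the integral sign:
dradial is continuous on a compact rectangle of parameters s and t. *)
Let dradial_bounded i x : U x -> exists d C : R, [/\ 0 < d,
  forall s, s \in `]0 - d, 0 + d[ -> U (x + s *: delta_mx 0 i) &
  forall s t, s \in `]0 - d, 0 + d[ -> 0 <= t <= 1 ->
    `|dradial i (x + s *: delta_mx 0 i) t| <= C].
Proof.
move=> Ux; set e := delta_mx 0 i.
have /nbhs_ballP[d2 /= d20 hd2] : \near x, U x by exact: open_nbhs_nbhs.
pose d := d2 / 2; have d0 : 0 < d by rewrite divr_gt0.
have Us s : s \in `[- d, d] -> U (x + s *: e).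
  rewrite in_itv /= -ler_norml => sd; apply: hd2.
  rewrite -ball_normE /ball_ /= opprD addNKr normrN normrZ.
  have e1 : `|e| <= 1.
    apply: norm_row_le => // j; rewrite !mxE eqxx /=.
    by case: (j == i); rewrite ?normr0 ?normr1.
  apply: (@le_lt_trans _ _ (d * 1)); first exact: ler_pM.
  by rewrite mulr1 /d ltr_pdivrMr// ltr_pMr// ltr1n.
pose A : set (R * R) := `[- d, d]%classic `*` `[0, 1]%classic.
pose y (q : R * R) := x + q.1 *: e - x0.
pose p (q : R * R) := x0 + q.2 *: y q.
have c1 (q : R * R) : {for q, continuous (fun q : R * R => q.1)} by exact: cvg_fst.
have c2 (q : R * R) : {for q, continuous (fun q : R * R => q.2)} by exact: cvg_snd.
have cy (q : R * R) : {for q, continuous y}.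
  apply: (@cvgB _ _ _ (nbhs q)); last exact: cvg_cst.
  apply: (@cvgD _ _ _ (nbhs q)); first exact: cvg_cst.
  by apply: (@cvgZr_tmp _ _ _ (nbhs q)); exact: c1.
have cp (q : R * R) : {for q, continuous p}.
  apply: (@cvgD _ _ _ (nbhs q)); first exact: cvg_cst.
  by apply: (@cvgZ _ _ _ (nbhs q)); [exact: c2|exact: cy].
have Up (q : R * R) : A q -> U (p q).
  by move=> [/= q1 q2]; apply: U_radial; [exact: Us|rewrite /= in_itv in q2].
have cont (g : 'rV[R]_N -> R) (q : R * R) : smooth_on U g -> A q ->
    {for q, continuous (g \o p)}.
  move=> sg Aq; have [cg _ _] := smooth_on_spec sg.
  by apply: continuous_comp; [exact: cp|apply: cg; exact: Up].
pose H (q : R * R) := dradial i (x + q.1 *: e) q.2.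
have cH (q : R * R) : A q -> {for q, continuous H}.
  move=> Aq; apply: (@cvgD _ _ _ (nbhs q)); first exact: (cont _ _ (sF i) Aq).
  apply: (@cvgM _ _ (nbhs q)); first exact: c2.
  apply: (@continuous_at_sum R _ _ _ (fun j q => y q 0 j * partial j (F i) (p q))).
  move=> j; have [_ _ sFi] := smooth_on_spec (sF i).
  apply: (@cvgM _ _ (nbhs q)); last exact: (cont _ _ (sFi j) Aq).
  exact: (@continuous_comp _ _ _ y (fun v : 'rV[R]_N => v 0 j) q (cy q)
    (@coord_continuous R 1 N 0 j (y q))).
have A0 : A !=set0.
  exists (0, 0); split; rewrite /= in_itv /= ?lexx ?ler01//.
  by rewrite oppr_le0 ltW.
have cA : compact A by apply: compact_setX; exact: segment_compact.
have [|c cA' hc] := @compact_EVT_max _ R (fun q => `|H q|) A A0 cA.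
  apply: continuous_in_subspaceT => q /set_mem Aq.
  by apply: (@cvg_norm _ _ _ (nbhs q)); exact: cH.
exists d, `|H c|; split; [exact: d0|move=> s|move=> s t].
  by rewrite sub0r add0r => /subset_itv_oo_cc; exact: Us.
rewrite sub0r add0r => /subset_itv_oo_cc sI tI.
by apply: (hc (s, t)); apply/mem_set; split => //=; rewrite in_itv.
Qed.

(** Differentiate under the integral sign, then integrate the t-derivative of
t * F i (x0 + t *: (x - x0)) between 0 and 1. *)
Lemma is_derive_potential i x : U x ->
  is_derive x (delta_mx 0 i) potential (F i x).
Proof.
move=> Ux; have [d [C [d0 hU hC]]] := dradial_bounded i Ux.
have D := is_derive_under_integral01 d0
  (fun s t sI tI => is_derive_radial (hU s sI) tI)
  (fun s sI => radial_continuous (hU s sI)) hC.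
have IE : \int[mu]_(t in `[0, 1]) dradial i (x + 0 *: delta_mx 0 i) t = F i x.
  rewrite scale0r addr0.
  have dG (t : R) : 0 <= t <= 1 ->
      is_derive t 1 (fun t => t * F i (x0 + t *: (x - x0))) (dradial i x t).
    move=> t01.
    have [dG vG] := @is_deriveM R R (fun t => t)
      (fun t => F i (x0 + t *: (x - x0))) t 1 _ _
      (is_derive_id _ _) (is_derive_smooth_along oU (sF i) (U_radial Ux t01)).
    by apply: DeriveDef dG _; rewrite vG /= [_ *: 1]mulr1 [RHS]addrC.
  have cG : {within `[0, 1], continuous (dradial i x)}.
    apply: within01 => t t01.
    have [_ _ sFi] := smooth_on_spec (sF i).
    apply: (@cvgD _ _ _ (nbhs t)); first exact: (cont_along (sF i) Ux t01).
    apply: (@cvgM _ _ (nbhs t)); first exact: cvg_id.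
    apply: (@continuous_at_sum R R _ _ (fun j (r : R) =>
      (x - x0) 0 j * partial j (F i) (x0 + r *: (x - x0))) t) => j.
    by apply: (@cvgMl_tmp R _ (nbhs t)); exact: (cont_along (sFi j) Ux t01).
  have -> := FTC01 dG cG.
  by rewrite mul1r mul0r subr0 scale1r addrC subrK.
have [D1 D2] := D; rewrite IE in D2.
have E : (fun h : R => h^-1 *:
      ((potential \o shift x) (h *: delta_mx 0 i) - potential x)) =
   (fun h : R => h^-1 *:
      (((fun s : R => potential (x + s *: delta_mx 0 i)) \o shift 0) (h *: 1) -
         potential (x + 0 *: delta_mx 0 i))).
  apply/funext => h /=.
  by rewrite [h *: 1]mulr1 !addr0 scale0r addr0 [x + _]addrC.
by apply: DeriveDef; rewrite /derivable /derive E.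
Qed.

Lemma smooth_potential : smooth_on U potential.
Proof.
have D i x : U x -> derivable potential x (delta_mx 0 i).
  by move=> Ux; have [] := is_derive_potential i Ux.
have pE i x : U x -> F i x = partial i potential x.
  by move=> Ux; have [_ <-] := is_derive_potential i Ux.
have cont x : U x -> {for x, continuous potential}.
  move=> Ux; apply: differentiable_continuous.
  apply: (differentiable_of_partials oU Ux D) => i.
  have [cF _ _] := smooth_on_spec (sF i).
  by apply: (continuous_at_eq_on oU Ux (pE i)); exact: cF.
case=> [|k]; split=> // i; split=> [x|]; first exact: D.
exact: Ck_on_eq (pE i) (sF i k).
Qed.

End Poincare.

(** * The recurrence for the gradients *)

Section Recurrence.
Variables (R : realType) (n : nat).
Local Notation N := (2 * n).+2.
Implicit Types (M B : 'M[R]_N) (U : set 'rV[R]_N) (f g : 'rV[R]_N -> R)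
  (V W : 'I_N -> 'rV[R]_N -> R).

Lemma jordan_nilpotent_N M : real_jordan_form_pm_i M ->
  (M *m M + 1%:M) ^+ n.+1 = 0.
Proof. by move=> hM; apply: jordan_nilpotent hM _; rewrite doubleS mul2n. Qed.

Lemma mu_system_recurrence M V x :
  (forall i, modulus R n %| (A_mu M *m grad_V_mu V x) i 0) <->
  (forall k : 'I_N, invmx M *m grad (V k) x +
     (if (k == 0 :> nat)%N then 0 else grad (V (inord k.-1)) x) =
     (modulus R n)`_k *: grad (V ord_max) x).
Proof.
pose D (k : nat) : 'cV[R]_N := if (k < N)%N then grad (V (inord k)) x else 0.
have D0 j : (N <= j)%N -> D j = 0 by move=> Nj; rewrite /D ltnNge Nj.
have DE (k : 'I_N) : D k = grad (V k) x by rewrite /D ltn_ord inord_val.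
have -> : grad_V_mu V x = \sum_(j < N) 'X^j *: map_mx polyC (D j).
  by apply: eq_bigr => j _; rewrite DE.
apply: iff_trans (dvd_A_mu_iff M D0) _.
rewrite -[D _]/(D (ord_max : 'I_N)) DE.
split=> [rec k|rec k kN].
  rewrite -DE -(rec _ (ltn_ord k)); congr (_ + _).
  case: k => [[|k]] //= kN; rewrite /D ifT//; exact: ltnW.
rewrite -[k]/(val (Ordinal kN)) -rec DE; congr (_ + _).
by case: k kN => [|k] //= kN; rewrite /D ifT//; exact: ltnW.
Qed.

Definition Hessian g x : 'M[R]_N := \matrix_(j, i) partial i (partial j g) x.

Lemma Hessian_sym U g x : open U -> U x -> smooth_on U g ->
  (Hessian g x)^T = Hessian g x.
Proof.
move=> oU Ux sg; apply/matrixP => i j.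
by rewrite !mxE (partial_comm _ _ oU Ux sg).
Qed.

Lemma smooth_on_mul_grad U B g k : open U -> smooth_on U g ->
  smooth_on U (fun x => \sum_j B k j * partial j g x).
Proof.
move=> oU sg; apply: smooth_on_sum => // j.
by have [_ _ +] := smooth_on_spec sg; apply.
Qed.

Lemma partial_mul_grad U B g k i x : open U -> U x -> smooth_on U g ->
  partial i (fun x => \sum_j B k j * partial j g x) x = (B *m Hessian g x) k i.
Proof.
move=> oU Ux sg; rewrite partial_sum; last first.
  move=> j; have [_ _ /(_ j)/smooth_on_spec[_ + _]] := smooth_on_spec sg; exact.
by rewrite !mxE; apply: eq_bigr => j _; rewrite mxE.
Qed.

(** M H is the Hessian of f, hence symmetric. *)
Lemma Hessian_selfadjoint M U f g x : open U -> U x ->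
  smooth_on U f -> smooth_on U g -> gradient_equation M U f g ->
  M *m Hessian g x = Hessian g x *m M^T.
Proof.
move=> oU Ux sf sg fg.
have E : Hessian f x = M *m Hessian g x.
  apply/matrixP => k i; rewrite -(partial_mul_grad M k i oU Ux sg) mxE.
  apply: partial_eq_on oU Ux _ => y Uy.
  have /matrixP/(_ k 0) := fg y Uy; rewrite !mxE => ->.
  by apply: eq_bigr => j _; rewrite mxE.
by rewrite -E -(Hessian_sym oU Ux sf) E trmx_mul (Hessian_sym oU Ux sg).
Qed.

(** B H is the Jacobian matrix of the field B grad g, so its symmetry says that
this field is closed. *)
Lemma exists_potential B U g : open U -> convex_set U -> smooth_on U g ->
  (forall x, U x -> B *m Hessian g x = Hessian g x *m B^T) ->
  exists2 h, smooth_on U h & gradient_equation B U h g.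
Proof.
move=> oU cU sg symB.
have [[x0 Ux0]|U0] := pselect (exists x, U x); last first.
  exists (fun=> 0); first exact: smooth_on_cst.
  by move=> x Ux; exfalso; apply: U0; exists x.
pose F k x := \sum_j B k j * partial j g x.
have sF k : smooth_on U (F k) by exact: smooth_on_mul_grad.
have closedF i j x : U x -> partial i (F j) x = partial j (F i) x.
  move=> Ux; rewrite !(partial_mul_grad _ _ _ oU Ux sg).
  have symBH : (B *m Hessian g x)^T = B *m Hessian g x.
    by rewrite trmx_mul (Hessian_sym oU Ux sg) symB.
  by rewrite -[in LHS]symBH mxE.
exists (potential F x0); first exact: smooth_potential.
move=> x Ux; apply/matrixP => i j; rewrite [j]ord1 !mxE.
have [_] := is_derive_potential oU cU Ux0 sF closedF i Ux.
by rewrite /partial => ->; apply: eq_bigr => k _; rewrite mxE.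
Qed.

Lemma mu_system_gradient M U V : (M *m M + 1%:M) ^+ n.+1 = 0 ->
  mu_system_solution M U V -> gradient_equation M U (V ord0) (V ord_max).
Proof.
move=> M0 [_ sys] x Ux.
have /mu_system_recurrence/(_ ord0) := sys x Ux.
rewrite eqxx addr0 modulus0 scale1r => <-.
by rewrite mulKVmx// (unitmx_of_nilpotent M0).
Qed.

(** V_k is a potential of B_k grad g. The two ends need no integration, as
B_0 = M and B_(N-1) = 1, and they are taken to be f and g themselves. *)
Lemma mu_system_exists M U f g : (M *m M + 1%:M) ^+ n.+1 = 0 ->
  open U -> convex_set U -> smooth_on U f -> smooth_on U g ->
  gradient_equation M U f g ->
  exists V, has_ends U f g V /\ mu_system_solution M U V.
Proof.
move=> M0 oU cU sf sg fg; have uM := unitmx_of_nilpotent M0.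
pose Y := - invmx M; pose P := modulus R n.
pose B k := horner_mx Y (drop_poly k.+1 P).
have BS k : horner_mx Y (drop_poly k P) = - (invmx M *m B k) + (P`_k)%:M.
  by rewrite horner_mx_drop mulNr.
have B0 : B 0 = M.
  have := BS 0; rewrite drop_poly0l horner_modulus_opp_inv// modulus0.
  move=> /esym/eqP; rewrite addrC subr_eq0 => /eqP/(congr1 (mulmx M)).
  by rewrite mulKVmx// mulmx1.
have BN : B N.-1 = 1%:M.
  rewrite /B BS /B drop_poly_eq0 ?size_modulus// rmorph0 mulmx0 oppr0 add0r.
  by have := monicP (monic_modulus R n); rewrite lead_coefE size_modulus => ->.
have /choice[V hV] (k : 'I_N) : exists h, [/\ smooth_on U h,
    gradient_equation (B k) U h g, k = ord0 -> h = f & k = ord_max -> h = g].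
  have [->|k0] := eqVneq k ord0; first by exists f; split=> //=; rewrite B0.
  have [->|kN] := eqVneq k ord_max.
    exists g; split=> //.
    by move=> x Ux; rewrite BN mul1mx.
  have [|h sh gh] := @exists_potential (B k) U g oU cU sg.
    move=> x Ux; apply: selfadjoint_horner; apply: selfadjoint_opp_inv => //.
    exact: Hessian_selfadjoint sf sg fg.
  by exists h; split=> // e; [rewrite e eqxx in k0|rewrite e eqxx in kN].
exists V; split.
  move=> x _; have [_ _ -> //] := hV ord0; have [_ _ _ -> //] := hV ord_max.
split=> [k|x Ux]; first by have [] := hV k.
apply/mu_system_recurrence => k.
have gV l : grad (V l) x = B l *m grad g x by have [_ + _ _] := hV l; apply.
rewrite !gV BN mul1mx mulmxA.
have -> : invmx M *m B k = (P`_k)%:M - horner_mx Y (drop_poly k P).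
  by rewrite BS opprD opprK addrCA subrr addr0.
rewrite mulmxBl mul_scalar_mx -addrA -[RHS]addr0; congr (_ + _).
case: k => [[|k]] kN /=.
  by rewrite drop_poly0l horner_modulus_opp_inv// mul0mx oppr0 addr0.
by rewrite inordK ?addNr//; exact: ltnW.
Qed.

(** Descending induction on k: the recurrence at k + 1 expresses the gradient of
V_k by those of V_(k+1) and V_(N-1). *)
Lemma mu_system_grad_unique M U f g V W : open U ->
  has_ends U f g V -> mu_system_solution M U V ->
  has_ends U f g W -> mu_system_solution M U W ->
  forall (k : 'I_N) x, U x -> grad (V k) x = grad (W k) x.
Proof.
move=> oU eV [_ sV] eW [_ sW] k x Ux.
have last : grad (V ord_max) x = grad (W ord_max) x.
  apply/matrixP => i j; rewrite !mxE; apply: partial_eq_on oU Ux _ => y Uy.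
  by have [_ ->] := eV y Uy; have [_ ->] := eW y Uy.
have /mu_system_recurrence recV := sV x Ux.
have /mu_system_recurrence recW := sW x Ux.
have [m km] := ubnP (N.-1 - k)%N; elim: m => // m IH in k km *.
have [->//|kN] := eqVneq k ord_max.
have kN' : (k.+1 < N)%N.
  by rewrite ltnS ltn_neqAle -ltnS ltn_ord andbT; exact: kN.
have := recV (Ordinal kN'); have := recW (Ordinal kN').
rewrite /= inord_val last IH => [<- /addrI //|/=].
by rewrite subnS -ltnS prednK ?subn_gt0// ltnS in km *.
Qed.

Lemma same_grad_const U f g : open U -> convex_set U ->
  smooth_on U f -> smooth_on U g ->
  (forall x, U x -> grad f x = grad g x) ->
  exists c : R, forall x, U x -> g x = f x + c.
Proof.
move=> oU cU sf sg fg.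
have [[x0 Ux0]|U0] := pselect (exists x, U x); last first.
  by exists 0 => x Ux; exfalso; apply: U0; exists x.
pose h x := -1 * f x + g x.
have sh : smooth_on U h by move=> k; apply: Ck_on_lincomb.
exists (h x0) => x Ux.
rewrite -(constant_on_convex oU cU sh _ Ux0 Ux).
  by rewrite /h mulN1r addNKr.
move=> i z Uz.
have [_ df _] := smooth_on_spec sf; have [_ dg _] := smooth_on_spec sg.
have [_ vh] := is_deriveD (is_deriveZ (-1) (derivableP (df i z Uz)))
  (derivableP (dg i z Uz)).
have -> : partial i h z = -1 *: partial i f z + partial i g z by exact: vh.
have /matrixP/(_ i 0) := fg z Uz; rewrite !mxE => ->.
by rewrite scaleN1r addNr.
Qed.

End Recurrence.

Theorem theorem4 (R : realType) (n : nat) (M : 'M[R]_((2 * n).+2))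
    (hM : real_jordan_form_pm_i M)
    (U : set 'rV[R]_((2 * n).+2)) (openU : open U) (convexU : convex_set U) :
  (forall V : 'I_(2 * n).+2 -> 'rV[R]_((2 * n).+2) -> R,
     mu_system_solution M U V ->
     gradient_equation M U (V ord0) (V ord_max)) /\
  (forall f g : 'rV[R]_((2 * n).+2) -> R,
     smooth_on U f -> smooth_on U g -> gradient_equation M U f g ->
     (exists V : 'I_(2 * n).+2 -> 'rV[R]_((2 * n).+2) -> R,
        has_ends U f g V /\ mu_system_solution M U V) /\
     (forall V W : 'I_(2 * n).+2 -> 'rV[R]_((2 * n).+2) -> R,
        has_ends U f g V -> mu_system_solution M U V ->
        has_ends U f g W -> mu_system_solution M U W ->
        forall k : 'I_(2 * n).+2, (0 < k < (2 * n).+1)%N ->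
        exists c : R, forall x, U x -> W k x = V k x + c)).
Proof.
have M0 := jordan_nilpotent_N hM.
split=> [V|f g sf sg fg]; first exact: mu_system_gradient.
split=> [|V W eV sV eW sW k _]; first exact: mu_system_exists.
apply: same_grad_const => //; [exact: sV.1|exact: sW.1|].
exact: mu_system_grad_unique eV sV eW sW k.
Qed.
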